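(* Let $\epsilon\in[0,\sqrt2]$. There exists $\bar\delta>0$ such that the following holds. Let $d^0\in\ell_\infty(\mathbb{Z})$ be a strictly positive sequence ($d^0_i>0$ for all $i$) or a strictly negative sequence ($d^0_i<0$ for all $i$), and let $d^k=S_\epsilon^{(1)}d^{k-1}$ for $k\ge1$. If $\rho(d^0)<\bar\delta$, then the subdivision process $(d^k)_{k\ge 0}$ converges to a $\mathcal{C}^{\alpha-}$ function with $\alpha=1-\frac12\log_2 3$; i.e. there is a continuous function $G:\mathbb{R}\to\mathbb{R}$ of class $\mathcal{C}^{\alpha-}$ such that $\lim_{k\to\infty}\sup_{i\in\mathbb{Z}}|d^k_i-G(i2^{-k})|=0$.
   Context: $\ell_\infty(\mathbb{Z})$ is the space of bounded real sequences indexed by $\mathbb{Z}$. For sequences $d$ with all entries positive or all entries negative, and $\epsilon\in[0,\sqrt2]$, the operator $S^{(1)}_\epsilon$ (which does not depend on $\epsilon$ on such sequences) is $$(S_\epsilon^{(1)}d)_{2i+j}=d_i\left(1+(-1)^jH\!\left(\frac{d_{i-1}}{d_i},\frac{d_{i+1}}{d_i}\right)\right),\quad j=0,1,\ i\in\mathbb{Z},\qquad H(x,y)=\frac{x-y}{2+x+y+2\sqrt{2+x+y}}.$$ It maps positive (negative) sequences to positive (negative) sequences. It is the first divided difference scheme of the interpolatory scheme $S_\epsilon$ with $(S_\epsilon f)_{2i}=f_i$, $(S_\epsilon f)_{2i+1}=\frac12f_i+\frac12f_{i+1}-\Gamma\,(f_{i+2}-f_{i+1}-f_i+f_{i-1})$,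 where on strictly monotone data $\Gamma=\frac12\left[\left(1+\sqrt{1+\frac{f_{i+2}-f_{i-1}}{f_{i+1}-f_i}}\right)^2-1\right]^{-1}$: if $d_i=2^k(f_{i+1}-f_i)$ then $(S^{(1)}_\epsilon d)_i=2^{k+1}((S_\epsilon f)_{i+1}-(S_\epsilon f)_i)$. For a sequence $d$ with all entries positive or all negative, $$\rho(d)=\sup_{i\in\mathbb{Z}}\max\left\{\left|\frac{d_i}{d_{i+1}}-1\right|,\left|\frac{d_{i+1}}{d_i}-1\right|\right\}\in[0,+\infty].$$ For $\alpha=n+\kappa$ with $n\in\mathbb{N}$ (including $0$) and $0<\kappa<1$, $G\in\mathcal{C}^\alpha$ means that $G^{(n)}$ exists and $|G^{(n)}(x)-G^{(n)}(y)|\le C|x-y|^\kappa$ for some constant $C$ and all $x,y$. $G\in\mathcal{C}^{\alpha-}$ means $G\in\mathcal{C}^{\alpha-\theta}$ for every sufficiently small $\theta>0$. *)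

(* Defs.v *)
From HB Require Import structures.
From mathcomp Require Export all_boot all_order all_algebra.
From mathcomp Require Export all_classical all_reals all_analysis.
Export Order.TTheory GRing.Theory Num.Theory.
Export numFieldNormedType.Exports.

Set Implicit Arguments.
Unset Strict Implicit.
Unset Printing Implicit Defensive.

Local Open Scope classical_set_scope.
Local Open Scope ring_scope.

Definition Hfun (R : realType) (x y : R) : R :=
  (x - y) / (2 + x + y + 2 * Num.sqrt (2 + x + y)).

(* First divided difference scheme, given by the formula valid on sequences
   that are everywhere positive or everywhere negative.  On those sequences it
   does not depend on the parameter eps, which is kept only to index the
   family.  The index m = 2i + j is decomposed by Euclidean division in int
   (i rounds towards -oo, j is 0 or 1); see S1E. *)
Definition S1 (R : realType) (eps : R) (d : int -> R) (m : int) : R :=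
  let i := (m %/ 2)%Z in
  let j := (m %% 2)%Z in
  d i * (1 + (-1) ^ j * Hfun (d (i - 1) / d i) (d (i + 1) / d i)).

Lemma S1E (R : realType) (eps : R) (d : int -> R) (i : int) (j : nat) :
  (j < 2)%N ->
  S1 eps d (2 * i + j%:Z) =
  d i * (1 + (-1) ^+ j * Hfun (d (i - 1) / d i) (d (i + 1) / d i)).
Proof.
move=> j2; rewrite /S1 (mulrC 2 i) divzMDl // modzMDl divz_small ?modz_small //.
by rewrite addr0 exprnP.
Qed.

Definition rho (R : realType) (d : int -> R) : \bar R :=
  ereal_sup (range (fun i : int =>
    (Num.max `|d i / d (i + 1) - 1| `|d (i + 1) / d i - 1|)%:E)).

(* derive1n is total: asking only that the (n-1)-st iterate be differentiable
   would not guarantee that the earlier iterates are genuine derivatives, hence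
   the condition at every order m < n. *)
Definition n_derivable (R : realType) (n : nat) (G : R -> R) : Prop :=
  forall m : nat, (m < n)%N -> forall x : R, derivable (derive1n m G) x 1.

Definition Cholder (R : realType) (alpha : R) (G : R -> R) : Prop :=
  exists (n : nat) (kappa : R),
    [/\ alpha = n%:R + kappa,
        0 < kappa < 1,
        n_derivable n G &
        exists C : R, forall x y : R,
          `|derive1n n G x - derive1n n G y| <= C * `|x - y| `^ kappa].

Definition Cholder_minus (R : realType) (alpha : R) (G : R -> R) : Prop :=
  exists2 theta0 : R, 0 < theta0 &
    forall theta : R, 0 < theta < theta0 -> Cholder (alpha - theta) G.

Definition subdivision_converges (R : realType) (d : nat -> int -> R)
    (G : R -> R) : Prop :=
  (fun k : nat => ereal_sup (range (fun i : int =>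
     `|d k i - G (i%:~R * 2 ^- k)|%:E))) @ \oo --> 0%E.

(* Main.v *)
(* The relative differences e_i = d_(i+1) / d_i - 1 of the data satisfy, up to
   terms quadratic in m = sup |e_i|, the difference scheme of the four-point
   scheme: e_(2i) becomes (e_(i-1) + e_i) / 4 and e_(2i+1) becomes
   3/4 e_i - (e_(i-1) + e_(i+1)) / 8.  The linear scheme is not contractive in
   one step, but its square has sup norm 3/4, so two steps map m to at most
   3/4 m + 25 m^2, and small data decay like s^k with s = sqrt 3 / 2 = 2^-alpha.
   The values d^k_i then stay bounded, d^k along the dyadic intervals containing
   x is a Cauchy sequence with geometric rate s^k, and comparing |x - y| with
   2^-k gives Hoelder regularity of the limit.  Only d_i != 0 and smallness of e
   are used, which treats both signs at once. *)
Require Import Defs.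
From mathcomp Require Import ring lra zify.

Set Implicit Arguments.
Unset Strict Implicit.
Unset Printing Implicit Defensive.

Local Open Scope classical_set_scope.
Local Open Scope ring_scope.

(** * Relative differences and the linearization of [Hfun] *)

Definition reldiff (R : realType) (d : int -> R) (i : int) : R :=
  d (i + 1) / d i - 1.

Definition reldiff_le (R : realType) (d : int -> R) (m : R) : Prop :=
  (forall i, d i != 0) /\ (forall i, `|reldiff d i| <= m).

Lemma ler_normM (R : realType) (x y a b : R) :
  `|x| <= a -> `|y| <= b -> `|x * y| <= a * b.
Proof. by move=> xa yb; rewrite normrM ler_pM. Qed.

Lemma ler_norm_div2 (R : realType) (h x m : R) :
  `|h| <= m / 2 -> 1/2 <= x -> `|h / x| <= m.
Proof.
move=> hm x2; have m0 : 0 <= m by have := normr_ge0 h; lra.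
rewrite normrM normfV (@ger0_norm _ x); last by lra.
by rewrite ler_pdivrMr; nra.
Qed.

Lemma sqrt_near4 (R : realType) (z t : R) : 0 <= z ->
  `|z - 4| <= t -> `|Num.sqrt z - 2| <= t / 2.
Proof.
move=> z0; have s0 := sqrtr_ge0 z.
have -> : z - 4 = (Num.sqrt z - 2) * (Num.sqrt z + 2).
  by rewrite -[in LHS](sqr_sqrtr z0); ring.
rewrite normrM (ger0_norm (x := _ + 2)) ?addr_ge0// => h.
rewrite ler_pdivlMr//; apply: le_trans h.
by rewrite ler_wpM2l// lerDr.
Qed.

(** First-order expansion at the constant data x = y = 1: the numerator is -(a + b) up to second
    order, and the denominator equals 8 there. *)
Lemma Hfun_linear (R : realType) (a b m : R) : m <= 1/16 ->
  `|a| <= m -> `|b| <= m ->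
  `|Hfun (1 + a)^-1 (1 + b) + (a + b) / 8| <= m ^+ 2.
Proof.
move=> m16 ha hb.
have m0 : 0 <= m := le_trans (normr_ge0 a) ha.
have a1 : 1/2 <= 1 + a by move: ha; rewrite ler_norml => /andP[? ?]; lra.
have ai : 0 <= (1 + a)^-1 <= 2.
  have a0 : 0 < 1 + a by lra.
  by rewrite invr_ge0 ltW//= -[_^-1]mul1r ler_pdivrMr//; lra.
(* Applied twice, this identity gives the exact expansion u = 1 - a + a^2 u. *)
set u := (1 + a)^-1; have uE : u = 1 - a * u.
  rewrite /u; field; lra.
have uge : `|u| <= 2 by rewrite ger0_norm; case/andP: ai.
have au : `|a * u| <= m * 2 by exact: ler_normM.
have aau : `|a * (a * u)| <= m * (m * 2) by exact: ler_normM.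
rewrite /Hfun; set z := 2 + u + (1 + b).
have hz : `|z - 4| <= 3 * m.
  rewrite /z; move: au hb; rewrite !ler_norml => /andP[? ?] /andP[? ?].
  by apply/andP; split; lra.
have z0 : 0 <= z by move: hz; rewrite ler_norml => /andP[? ?]; lra.
have hs := sqrt_near4 z0 hz.
set D := z + 2 * Num.sqrt z.
have hD : `|D - 8| <= 6 * m.
  move: hs hz; rewrite /D !ler_norml => /andP[? ?] /andP[? ?].
  by apply/andP; split; lra.
have D5 : 5 <= D by move: hD; rewrite ler_norml => /andP[? ?]; lra.
(* Both terms of the new numerator are quadratic: at most 16 m^2 and 12 m^2, against 8 D >= 40. *)
have -> : (u - (1 + b)) / D + (a + b) / 8 =
    (8 * (a * (a * u)) + (a + b) * (D - 8)) / (8 * D).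
  have -> : u - (1 + b) = - (a + b) + a * (a * u).
    by rewrite [in LHS]uE [in LHS]uE; ring.
  by field; lra.
have hab : `|a + b| <= 2 * m by apply: le_trans (ler_normD _ _) _; lra.
have habD := ler_normM hab hD.
rewrite normrM normfV (@ger0_norm _ (8 * D)); last by lra.
rewrite ler_pdivrMr; last by lra.
apply: le_trans (ler_normD _ _) _.
rewrite normrM (ger0_norm (x := 8))//.
have : m ^+ 2 * 5 <= m ^+ 2 * D by rewrite ler_wpM2l// sqr_ge0.
by move: aau habD; nra.
Qed.

(** * One step of the scheme on relative differences *)

Definition Hval (R : realType) (d : int -> R) (i : int) : R :=
  Hfun (d (i - 1) / d i) (d (i + 1) / d i).

Lemma S1_even (R : realType) (eps : R) d i :
  S1 eps d (2 * i) = d i * (1 + Hval d i).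
Proof. by have := @S1E R eps d i 0 isT; rewrite addr0 expr0 mul1r. Qed.

Lemma S1_odd (R : realType) (eps : R) d i :
  S1 eps d (2 * i + 1) = d i * (1 - Hval d i).
Proof. by have := @S1E R eps d i 1 isT; rewrite expr1 mulN1r. Qed.

Lemma int_parity_ind (P : int -> Prop) :
  (forall i, P (2 * i)) -> (forall i, P (2 * i + 1)) -> forall i, P i.
Proof.
move=> Pe Po i; rewrite (divz_eq i 2) mulrC.
have := modz_ge0 i (isT : (2 : int) != 0).
have := ltz_pmod i (isT : (0 : int) < 2).
case: (_ %% _)%Z => [[|[|k]]|k] // _ _; by rewrite ?addr0.
Qed.

Lemma Hval_linear (R : realType) (m : R) d
    (m16 : m <= 1/16) (hd : reldiff_le d m) i :
  `|Hval d i + (reldiff d (i - 1) + reldiff d i) / 8| <= m ^+ 2.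
Proof.
have [d0 em] := hd.
have -> : Hval d i = Hfun (1 + reldiff d (i - 1))^-1 (1 + reldiff d i).
  have K (x : R) : 1 + (x - 1) = x by rewrite addrC subrK.
  by rewrite /Hval /reldiff !K subrK invf_div.
exact: Hfun_linear.
Qed.

Lemma Hval_le (R : realType) (m : R) d
    (m16 : m <= 1/16) (hd : reldiff_le d m) i :
  `|Hval d i| <= m / 2.
Proof.
have := Hval_linear m16 hd i; have := hd.2 i; have := hd.2 (i - 1).
have m0 : 0 <= m by apply: le_trans (hd.2 0).
rewrite !ler_norml => /andP[? ?] /andP[? ?] /andP[? ?].
have mm : m ^+ 2 <= m / 16.
  by rewrite expr2 ler_wpM2l//; lra.
by apply/andP; split; lra.
Qed.

Lemma S1_neq0 (R : realType) (eps m : R) d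
    (m16 : m <= 1/16) (hd : reldiff_le d m) i :
  S1 eps d i != 0.
Proof.
have [d0 _] := hd.
elim/int_parity_ind: i => i; rewrite ?S1_even ?S1_odd mulf_neq0 //;
  have := Hval_le m16 hd i; rewrite ler_norml => /andP[? ?];
  apply: lt0r_neq0; lra.
Qed.

(** The two children of [d i] have ratio (1 - h) / (1 + h), so their relative difference is -2h up
    to second order. *)
Lemma reldiff_S1_even (R : realType) (eps m : R) d
    (m16 : m <= 1/16) (hd : reldiff_le d m) i :
  `|reldiff (S1 eps d) (2 * i) - (reldiff d (i - 1) + reldiff d i) / 4|
  <= 5 * m ^+ 2.
Proof.
have [d0 _] := hd.
rewrite [X in `|X - _|]/reldiff S1_even S1_odd.
move: (Hval_linear m16 hd i) (Hval_le m16 hd i).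
set h := Hval d i => hl hm.
have h1 : 1/2 <= 1 + h by move: hm; rewrite ler_norml => /andP[? ?]; lra.
have -> : d i * (1 - h) / (d i * (1 + h)) - 1 =
    - 2 * h + 2 * (h * (h / (1 + h))).
  by field; rewrite d0; lra.
have hh := ler_norm_div2 hm h1.
have := ler_normM hm hh; move: hl; rewrite !ler_norml => /andP[? ?] /andP[? ?].
by apply/andP; split; nra.
Qed.

(** Here the children have adjacent parents and ratio (1 + e_i)(1 + h') / (1 - h), whose linear part
    is e_i + h + h'. *)
Lemma reldiff_S1_odd (R : realType) (eps m : R) d
    (m16 : m <= 1/16) (hd : reldiff_le d m) i :
  `|reldiff (S1 eps d) (2 * i + 1)
    - (3 / 4 * reldiff d i - (reldiff d (i - 1) + reldiff d (i + 1)) / 8)|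
  <= 5 * m ^+ 2.
Proof.
have [d0 em] := hd.
rewrite [X in `|X - _|]/reldiff.
have -> : 2 * i + 1 + 1 = 2 * (i + 1) by lia.
rewrite S1_even S1_odd.
move: (Hval_linear m16 hd i) (Hval_le m16 hd i).
move: (Hval_linear m16 hd (i + 1)) (Hval_le m16 hd (i + 1)).
rewrite addrK.
set h := Hval d i; set h' := Hval d (i + 1) => hl' hm' hl hm.
have h1 : 1/2 <= 1 - h by move: hm; rewrite ler_norml => /andP[? ?]; lra.
have -> : d (i + 1) = d i * (1 + reldiff d i).
  by rewrite /reldiff; field; exact: d0.
(* The relative difference is n / (1 - h). The errors are 2 m^2 from linearizing h and h', m^2 / 2
   from e_i h', and 5/2 m^2 from the division: 5 m^2 in all. *)
set n := reldiff d i + h' + h + reldiff d i * h'.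
have -> : d i * (1 + reldiff d i) * (1 + h') / (d i * (1 - h)) - 1 =
    n + n * (h / (1 - h)).
  by rewrite /n; field; rewrite d0; lra.
have hh := ler_norm_div2 hm h1.
have eh := ler_normM (em i) hm'.
have m0 : 0 <= m by apply: le_trans (em i).
have mm : m * m <= m / 16 by rewrite ler_wpM2l//; lra.
have hn : `|n| <= 5 / 2 * m.
  move: hm hm' (em i) eh; rewrite /n !ler_norml.
  by move=> /andP[? ?] /andP[? ?] /andP[? ?] /andP[? ?]; apply/andP; split; lra.
have := ler_normM hn hh; move: (n * _) => v; move: hl hl' eh; rewrite /n expr2.
rewrite !ler_norml => /andP[? ?] /andP[? ?] /andP[? ?] /andP[? ?].
by apply/andP; split; lra.
Qed.

(** The absolute coefficient sums of the linear rules are 1/2 (even) and 1 (odd). *)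
Lemma reldiff_le_S1 (R : realType) (eps m : R) d : m <= 1/16 ->
  reldiff_le d m -> reldiff_le (S1 eps d) (m + 5 * m ^+ 2).
Proof.
move=> m16 hd; have [_ em] := hd; split; first exact: S1_neq0 m16 hd.
elim/int_parity_ind => i.
  have := reldiff_S1_even eps m16 hd i; move: (em i) (em (i - 1)).
  rewrite !ler_norml => /andP[? ?] /andP[? ?] /andP[? ?].
  by apply/andP; split; lra.
have := reldiff_S1_odd eps m16 hd i; move: (em i) (em (i - 1)) (em (i + 1)).
rewrite !ler_norml => /andP[? ?] /andP[? ?] /andP[? ?] /andP[? ?].
by apply/andP; split; lra.
Qed.

(** * Two-step contraction, geometric decay and boundedness *)

Lemma reldiff_leW (R : realType) (d : int -> R) m m' :
  m <= m' -> reldiff_le d m -> reldiff_le d m'.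
Proof. by move=> mm [d0 h]; split=> // i; apply: le_trans mm. Qed.

(** Composing the linear rules gives one rule per residue mod 4; in the order of the cases below,
    the absolute coefficient sums are 5/16, 5/16, 1/4 and 3/4. Cancellation between the coefficients
    makes the last one less than 1. *)
Lemma reldiff_le_S1S1 (R : realType) (eps m : R) d : m <= 1/32 ->
  reldiff_le d m -> reldiff_le (S1 eps (S1 eps d)) (3 / 4 * m + 25 * m ^+ 2).
Proof.
move=> m32 hd; have m0 : 0 <= m by apply: le_trans (hd.2 0).
have m16 : m <= 1/16 by lra.
(* This crude bound enters only the quadratic error, which totals 5 m^2 + 5 (2m)^2 = 25 m^2. *)
have hd1 : reldiff_le (S1 eps d) (2 * m).
  by apply: reldiff_leW (reldiff_le_S1 eps m16 hd); nra.
have m16' : 2 * m <= 1/16 by lra.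
split; first exact: (S1_neq0 eps m16' hd1).
have [_ em] := hd.
have ev := reldiff_S1_even eps m16 hd; have od := reldiff_S1_odd eps m16 hd.
have ev2 := reldiff_S1_even eps m16' hd1.
have od2 := reldiff_S1_odd eps m16' hd1.
elim/int_parity_ind => i; move: i; elim/int_parity_ind => i.
- have := ev2 (2 * i).
  have -> : 2 * i - 1 = 2 * (i - 1) + 1 by lia.
  have := ev i; have := od (i - 1); rewrite subrK.
  have := em i; have := em (i - 1); have := em (i - 1 - 1).
  rewrite !ler_norml => /andP[? ?] /andP[? ?] /andP[? ?] /andP[? ?]
    /andP[? ?] /andP[? ?].
  by apply/andP; split; nra.
- have := ev2 (2 * i + 1); rewrite addrK.
  have := ev i; have := od i.
  have := em i; have := em (i - 1); have := em (i + 1).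
  rewrite !ler_norml => /andP[? ?] /andP[? ?] /andP[? ?] /andP[? ?]
    /andP[? ?] /andP[? ?].
  by apply/andP; split; nra.
- have := od2 (2 * i).
  have -> : 2 * i - 1 = 2 * (i - 1) + 1 by lia.
  have := ev i; have := od (i - 1); have := od i; rewrite subrK.
  have := em i; have := em (i - 1); have := em (i - 1 - 1); have := em (i + 1).
  rewrite !ler_norml => /andP[? ?] /andP[? ?] /andP[? ?] /andP[? ?]
    /andP[? ?] /andP[? ?] /andP[? ?] /andP[? ?].
  by apply/andP; split; nra.
- have := od2 (2 * i + 1); rewrite addrK.
  have -> : 2 * i + 1 + 1 = 2 * (i + 1) by lia.
  have := ev i; have := ev (i + 1); have := od i; rewrite addrK.
  have := em i; have := em (i - 1); have := em (i + 1).
  rewrite !ler_norml => /andP[? ?] /andP[? ?] /andP[? ?] /andP[? ?]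
    /andP[? ?] /andP[? ?] /andP[? ?].
  by apply/andP; split; nra.
Qed.

(* The factor 2 - s^k absorbs the quadratic error: with t = s^k, the bound two
   steps later exceeds 3/4 of the current one by 3/16 t^2 / 1000. *)
Lemma reldiff_le_iter (R : realType) (eps s : R) d :
  1/2 <= s <= 1 -> s ^+ 2 = 3 / 4 -> reldiff_le d (1/4000) ->
  forall k, reldiff_le (iter k (S1 eps) d) (s ^+ k * (2 - s ^+ k) / 1000).
Proof.
move=> /andP[s2 s1] ss hd k.
(* The contraction spans two steps, so the induction carries two consecutive levels. *)
suff : reldiff_le (iter k (S1 eps) d) (s ^+ k * (2 - s ^+ k) / 1000) /\
       reldiff_le (iter k.+1 (S1 eps) d) (s ^+ k.+1 * (2 - s ^+ k.+1) / 1000).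
  by case.
elim: k => [|k [IH0 IH1]]; split => //.
- by apply: reldiff_leW hd; rewrite expr0; lra.
- apply: reldiff_leW (reldiff_le_S1 eps _ hd); last by lra.
  by rewrite expr1; nra.
- have t0 : 0 <= s ^+ k by rewrite exprn_ge0//; lra.
  have t1 : s ^+ k <= 1 by rewrite exprn_ile1//; lra.
  apply: reldiff_leW (reldiff_le_S1S1 eps _ IH0); last by nra.
  have -> : s ^+ k.+2 = 3 / 4 * s ^+ k by rewrite -addn2 exprD ss mulrC.
  set t := s ^+ k in t0 t1 *.
  (* This bounds the quadratic error by t^2 / 10000, within the slack. *)
  have : (t * (2 - t)) ^+ 2 <= (2 * t) ^+ 2 by rewrite lerXn2r ?nnegrE; nra.
  by nra.
Qed.

(* Again 2 - s^k leaves room for the factor 1 + s^k / 1000 of each step. *)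
Lemma iter_S1_bounded (R : realType) (eps s B : R) d :
  0 <= s <= 9/10 ->
  (forall k, reldiff_le (iter k (S1 eps) d) (s ^+ k / 500)) ->
  (forall i, `|d i| <= B) ->
  forall k i, `|iter k (S1 eps) d i| <= B * (2 - s ^+ k).
Proof.
move=> /andP[s0 s9] hd dB k.
have B0 : 0 <= B := le_trans (normr_ge0 _) (dB 0).
elim: k => [|k IH] i; first by rewrite expr0 /=; have := dB i; lra.
have t0 : 0 <= s ^+ k by rewrite exprn_ge0.
have t1 : s ^+ k <= 1 by rewrite exprn_ile1//; lra.
have m16 : s ^+ k / 500 <= 1/16 by lra.
have Hm := Hval_le m16 (hd k); rewrite iterS.
have key (x y : R) : `|x| <= B * (2 - s ^+ k) -> `|y| <= s ^+ k / 500 / 2 ->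
    `|x * (1 + y)| <= B * (2 - s ^+ k.+1).
  move=> xB yt; have y1 : `|1 + y| <= 1 + s ^+ k / 500 / 2.
    by apply: le_trans (ler_normD _ _) _; rewrite normr1; lra.
  apply: le_trans (ler_normM xB y1) _.
  (* As 1 - s >= 1/10, the gain (1 - s) t exceeds the growth 2t / 1000. *)
  rewrite -mulrA ler_wpM2l// exprS; set t := s ^+ k in t0 t1 *.
  by nra.
by elim/int_parity_ind: i => i; rewrite ?S1_even ?S1_odd; apply: key;
  rewrite ?normrN.
Qed.

(** * Limit function along nested dyadic intervals *)

Lemma floor_double (R : realType) (x : R) :
  Num.floor (x * 2) = 2 * Num.floor x \/
  Num.floor (x * 2) = 2 * Num.floor x + 1.
Proof.
have /andP[] := floor_itv x; rewrite intrD; set n := Num.floor x => h1 h2.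
case: (ltP x (n%:~R + 1/2)) => h; [left|right]; apply: floor_def;
  by rewrite ?intrD ?intrM; apply/andP; split; lra.
Qed.

(** With c' = c / (1 - s), the intervals of centre u_k and radius c' s^k are nested, because c' s^k
    - c' s^(k+1) = c s^k. The supremum of the left endpoints lies in all of them. *)
Lemma geometric_cauchy_limit (R : realType) (c s : R) (u : nat -> R) :
  0 <= s < 1 -> 0 <= c -> (forall k, `|u k.+1 - u k| <= c * s ^+ k) ->
  exists g, forall k, `|g - u k| <= c / (1 - s) * s ^+ k.
Proof.
move=> /andP[s0 s1] c0 hu; set c' := c / (1 - s).
have cE : c = c' * (1 - s) by rewrite /c'; field; lra.
have c'0 : 0 <= c' by rewrite divr_ge0//; lra.
pose v k := u k - c' * s ^+ k; pose w k := u k + c' * s ^+ k.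
have vhomo : {homo v : n m / (n <= m)%N >-> n <= m}.
  apply/nondecreasing_seqP => n; rewrite /v exprS.
  by have := hu n; rewrite cE ler_norml => /andP[? ?]; lra.
have whomo : {homo w : n m / (n <= m)%N >-> m <= n}.
  apply/nonincreasing_seqP => n; rewrite /w exprS.
  by have := hu n; rewrite cE ler_norml => /andP[? ?]; lra.
have vw j k : v j <= w k.
  apply: (le_trans (vhomo _ _ (leq_maxl j k))).
  apply: (le_trans _ (whomo _ _ (leq_maxr j k))).
  have : 0 <= c' * s ^+ maxn j k by rewrite mulr_ge0 ?exprn_ge0.
  by rewrite /v /w; lra.
exists (sup (range v)) => k; rewrite ler_norml; apply/andP; split.
  have : v k <= sup (range v).
    apply: ub_le_sup; last by exists k.
    by exists (w 0) => _ [j _ <-].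
  by rewrite /v; lra.
have : sup (range v) <= w k.
  apply: ge_sup; first by exists (v 0), 0.
  by move=> _ [j _ <-].
by rewrite /w; lra.
Qed.

(** The index of the dyadic interval containing x at level k+1 is a child of the one at level k, so
    the values along these indices have geometric increments. *)
Lemma dyadic_limit (R : realType) (c s : R) (D : nat -> int -> R) :
  0 <= s < 1 -> 0 <= c ->
  (forall k i, `|D k.+1 (2 * i) - D k i| <= c * s ^+ k) ->
  (forall k i, `|D k.+1 (2 * i + 1) - D k i| <= c * s ^+ k) ->
  exists G : R -> R, forall k x,
    `|G x - D k (Num.floor (x * 2 ^+ k))| <= c / (1 - s) * s ^+ k.
Proof.
move=> s01 c0 De Do.
suff h (x : R) : exists g, forall k,
    `|g - D k (Num.floor (x * 2 ^+ k))| <= c / (1 - s) * s ^+ k.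
  by have [G GP] := choice h; exists G => k x; apply: GP.
pose u k := D k (Num.floor (x * 2 ^+ k)).
apply: (geometric_cauchy_limit (u := u)) => // k; rewrite /u exprSr mulrA.
by case: (floor_double (x * 2 ^+ k)) => ->.
Qed.

(** * Modulus of continuity and Hoelder regularity *)

Lemma floor_close (R : realType) (x y : R) : x <= y <= x + 1 ->
  Num.floor y = Num.floor x \/ Num.floor y = Num.floor x + 1.
Proof.
move=> /andP[xy yx].
have /andP[h1 h2] := floor_itv x; rewrite intrD in h2.
case: (ltP y ((Num.floor x)%:~R + 1)) => h; [left|right]; apply: floor_def;
  by rewrite ?intrD; apply/andP; split; lra.
Qed.

(** At level k the indices of x and y are equal or adjacent: two approximation errors and at most
    one neighbour difference. *)
Lemma dyadic_limit_modulus (R : realType) (c a s : R) (D : nat -> int -> R)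
    (G : R -> R) : 0 <= s -> 0 <= a ->
  (forall k i, `|D k (i + 1) - D k i| <= a * s ^+ k) ->
  (forall k x, `|G x - D k (Num.floor (x * 2 ^+ k))| <= c * s ^+ k) ->
  forall k x y, `|x - y| <= 2 ^- k -> `|G x - G y| <= (2 * c + a) * s ^+ k.
Proof.
move=> s0 a0 hD hG k x y; wlog xy : x y / x <= y.
  move=> W; case: (leP x y) => [|/ltW]; first exact: W.
  by rewrite distrC (distrC (G x)); exact: W.
rewrite distrC ger0_norm ?subr_ge0// => xyk.
have p0 : (0 : R) < 2 ^+ k by rewrite exprn_gt0.
have close : x * 2 ^+ k <= y * 2 ^+ k <= x * 2 ^+ k + 1.
  rewrite ler_pM2r// xy/=.
  by move: xyk; rewrite -(ler_pM2r p0) mulVf ?gt_eqF// mulrBl; lra.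
have t0 : 0 <= a * s ^+ k by rewrite mulr_ge0// exprn_ge0.
have := hG k x; have := hG k y; have := hD k (Num.floor (x * 2 ^+ k)).
case: (floor_close close) => ->;
rewrite !ler_norml => /andP[? ?] /andP[? ?] /andP[? ?];
by apply/andP; split; lra.
Qed.

Lemma dyadic_bracket (R : realType) (t : R) : 0 < t <= 1 ->
  exists k, 2 ^- k.+1 < t <= 2 ^- k.
Proof.
move=> /andP[t0 t1].
have ex : exists k, 2 ^- k.+1 < t.
  exists (Num.bound t^-1).
  have h := upper_nthrootP (leqnn (Num.bound t^-1)).
  rewrite -[ltRHS]invrK ltf_pV2 ?posrE ?exprn_gt0 ?invr_gt0//.
  by apply: lt_le_trans h _; rewrite ler_eXn2l ?ltr1n.
(* Minimality of k gives the upper bound, except at k = 0, where it is t <= 1. *)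
case: (ex_minnP ex) => k hk kmin; exists k; rewrite hk/=.
case: k hk kmin => [|k] _ kmin; first by rewrite expr0 invr1.
by rewrite leNgt; apply/negP => /kmin; rewrite ltnn.
Qed.

(** If 2^-(k+1) < |x - y| <= 2^-k, then s^k <= 2^(-k kappa) <= (2 |x - y|)^kappa, whence the factor
    2^kappa. Distances above 1 are covered by the bound 2M. *)
Lemma dyadic_modulus_hoelder (R : realType) (C s M kappa : R) (G : R -> R) :
  0 < kappa -> 0 <= s <= 2 `^ (- kappa) -> 0 <= C ->
  (forall k x y, `|x - y| <= 2 ^- k -> `|G x - G y| <= C * s ^+ k) ->
  (forall x, `|G x| <= M) ->
  forall x y, `|G x - G y| <= (C * 2 `^ kappa + 2 * M) * `|x - y| `^ kappa.
Proof.
move=> k0 /andP[s0 sq] C0 hG GM x y.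
have M0 : 0 <= M := le_trans (normr_ge0 _) (GM 0).
have [->|nxy] := eqVneq x y.
  by rewrite subrr normr0 mulr_ge0 ?powR_ge0// addr_ge0 ?mulr_ge0 ?powR_ge0.
have t0 : 0 < `|x - y| by rewrite normr_gt0 subr_eq0.
set t := `|x - y| in t0 *.
have pw0 := powR_ge0 t kappa; have pk0 := powR_ge0 (2 : R) kappa.
case: (leP t 1) => t1; last first.
  have : 1 <= t `^ kappa.
    rewrite -(powRr0 t); apply: ler_powR; exact: ltW.
  have : `|G x - G y| <= 2 * M.
    by apply: le_trans (ler_normB _ _) _; have := GM x; have := GM y; lra.
  have : 0 <= C * 2 `^ kappa by rewrite mulr_ge0.
  by nra.
have [|k /andP[h1 h2]] := @dyadic_bracket R t; first by rewrite t0.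
apply: (le_trans (hG _ _ _ h2)).
have -> : (C * 2 `^ kappa + 2 * M) * t `^ kappa =
    C * (2 * t) `^ kappa + 2 * M * t `^ kappa.
  by rewrite powRM ?ltW//; ring.
have : C * s ^+ k <= C * (2 * t) `^ kappa.
  rewrite ler_wpM2l//.
  apply: (@le_trans _ _ ((2 `^ (- kappa)) ^+ k)).
    by rewrite lerXn2r ?nnegrE ?powR_ge0.
  rewrite -powR_mulrn ?powR_ge0// -powRrM mulNr mulrC -mulNr powRrM.
  apply: ge0_ler_powR; rewrite ?nnegrE ?powR_ge0 ?mulr_ge0 ?ltW//.
  rewrite powRN powR_mulrn//.
  by move: h1; rewrite exprS invfM; lra.
have : 0 <= 2 * M * t `^ kappa by rewrite !mulr_ge0.
by lra.
Qed.

Lemma dyadic_modulus_continuous (R : realType) (C s : R) (G : R -> R) :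
  0 <= s < 1 ->
  (forall k x y, `|x - y| <= 2 ^- k -> `|G x - G y| <= C * s ^+ k) ->
  continuous G.
Proof.
move=> /andP[s0 s1] hG x; apply/cvgrPdist_le => e e0.
have sk : geometric C s n @[n --> \oo] --> 0.
  by apply: cvg_geometric; rewrite ger0_norm.
have [k _ hk] := cvgr_dist_le _ _ sk _ e0.
have p0 : (0 : R) < 2 ^- k by rewrite invr_gt0 exprn_gt0.
apply: (filterS _ (cvgr_dist_le _ _ (@cvg_id _ (nbhs x)) _ p0)) => y /hG h.
apply: le_trans h _.
have := hk k (leqnn k); rewrite sub0r normrN => h1.
exact: le_trans (ler_norm _) h1.
Qed.

(** * Uniform convergence and data with small [rho] *)

Lemma ler_reldiff (R : realType) (d : int -> R) m i :
  reldiff_le d m -> `|d (i + 1) - d i| <= `|d i| * m.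
Proof.
move=> [d0 em].
have -> : d (i + 1) - d i = d i * reldiff d i.
  by rewrite /reldiff; field; exact: d0.
exact: ler_normM.
Qed.

Lemma rho_reldiff_le (R : realType) (d : int -> R) m :
  (forall i, d i != 0) -> (rho d < m%:E)%E -> reldiff_le d m.
Proof.
move=> d0 rm; split=> // i.
have : ((Num.max `|d i / d (i + 1) - 1| `|d (i + 1) / d i - 1|)%:E <= rho d)%E.
  by apply: ereal_sup_ubound; exists i.
move=> /le_lt_trans/(_ rm); rewrite lte_fin gt_max => /andP[_ h].
exact: ltW h.
Qed.

(** At the grid point i 2^-k the floor is exactly i, so the pointwise estimate is uniform in i. *)
Lemma subdivision_converges_geometric (R : realType) (c s : R)
    (D : nat -> int -> R) (G : R -> R) : 0 <= s < 1 ->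
  (forall k x, `|G x - D k (Num.floor (x * 2 ^+ k))| <= c * s ^+ k) ->
  subdivision_converges D G.
Proof.
move=> /andP[s0 s1] hG.
have sk : geometric c s n @[n --> \oo] --> 0.
  by apply: cvg_geometric; rewrite ger0_norm.
have hk : (geometric c s n)%:E @[n --> \oo] --> 0%E.
  by apply: cvg_EFin => //; near=> n.
apply: squeeze_cvge (cvg_cst _) hk; near=> k; apply/andP; split.
  apply: (@le_trans _ _ (`|D k 0 - G (0%:~R * 2 ^- k)|%:E)).
    by rewrite lee_fin.
  by apply: ereal_sup_ubound; exists 0.
apply: ge_ereal_sup => _ [i _ <-]; rewrite lee_fin distrC.
have := hG k (i%:~R * 2 ^- k).
rewrite mulfVK ?expf_neq0//.
by rewrite (floor_def (m := i)) // lexx/= intrD ltrDl.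
Unshelve. all: by end_near. Qed.

(** * The exponent and its decay rate *)

Local Notation alpha R := (1 - 2^-1 * (ln 3 / ln 2) : R) (only parsing).

Lemma alpha_itv (R : realType) : 0 < alpha R < 1.
Proof.
have l2 : 0 < ln 2 :> R by rewrite ln_gt0// ltr1n.
have l3 : 0 < ln 3 :> R by rewrite ln_gt0// ltr1n.
have l34 : ln 3 < ln 2 + ln 2 :> R.
  by rewrite -lnM ?posrE// ltr_ln ?posrE//; lra.
have h0 : 0 < ln 3 / ln 2 :> R by rewrite divr_gt0.
have h2 : ln 3 / ln 2 < 2 :> R by rewrite ltr_pdivrMr//; lra.
by apply/andP; split; lra.
Qed.

(** -2 alpha = log_2 3 - 2: the rate 2^(-alpha) is the square root of the two-step contraction
    factor. *)
Lemma powR2_alpha_sqr (R : realType) : (2 `^ (- alpha R)) ^+ 2 = 3 / 4.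
Proof.
have l2 : 0 < ln 2 :> R by rewrite ln_gt0// ltr1n.
rewrite -powR_mulrn ?powR_ge0// -powRrM /powR pnatr_eq0/=.
have -> : - alpha R * 2 * ln 2 = ln 3 - ln 2 - ln 2.
  by field; exact: lt0r_neq0.
by rewrite !expRB !lnK ?posrE//; field.
Qed.

(** * Assembly for data of constant sign *)

Theorem theorem23 (R : realType) (eps : R) (heps : 0 <= eps <= Num.sqrt 2) :
  exists2 delta : R, 0 < delta &
    forall d0 : int -> R,
      bounded_fun d0 ->
      (forall i : int, 0 < d0 i) \/ (forall i : int, d0 i < 0) ->
      (rho d0 < delta%:E)%E ->
      exists G : R -> R,
        [/\ continuous G,
            Cholder_minus (1 - 2^-1 * (ln 3 / ln 2)) G &
            subdivision_converges (fun k : nat => iter k (S1 eps) d0) G].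
Proof.
(* Small enough that levels 0 and 1 satisfy the decay bound, s (2 - s) being at least 3/4. *)
exists (1/4000) => [|d0 /pinfty_ex_gt0[B _ dB] dsg rd]; first by lra.
have {}dB i : `|d0 i| <= B by exact: dB.
have dn0 i : d0 i != 0.
  by case: dsg => h; [exact: lt0r_neq0|exact: ltr0_neq0].
have hd := rho_reldiff_le dn0 rd.
have /andP[al0 al1] := alpha_itv R; have ss := powR2_alpha_sqr R.
set a := 1 - _ in al0 al1 ss *; set s := 2 `^ (- a) in ss.
have s0 : 0 <= s by exact: powR_ge0.
have s2 : 1/2 <= s by rewrite -(ler_pXn2r (n := 2)) ?nnegrE// ss; lra.
have s9 : s <= 9/10 by rewrite -(ler_pXn2r (n := 2)) ?nnegrE// ?ss; lra.
have s01 : 0 <= s < 1 by rewrite s0; lra.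
have sk0 k : 0 <= s ^+ k by rewrite exprn_ge0.
have hit k : reldiff_le (iter k (S1 eps) d0) (s ^+ k / 500).
  have s21 : 1/2 <= s <= 1 by rewrite s2; lra.
  apply: reldiff_leW (reldiff_le_iter eps s21 ss hd k).
  by have := sk0 k; nra.
have B0 : 0 <= B := le_trans (normr_ge0 _) (dB 0).
have s09 : 0 <= s <= 9/10 by rewrite s0.
have hB k i : `|iter k (S1 eps) d0 i| <= 2 * B.
  apply: le_trans (iter_S1_bounded s09 hit dB k i) _.
  by rewrite mulrC ler_wpM2r//; have := sk0 k; lra.
have hm k : s ^+ k / 500 <= 1/16.
  have : s ^+ k <= 1 by rewrite exprn_ile1//; lra.
  by lra.
(* A child differs from its parent [d i] by [d i] times plus or minus [Hval d i]. *)
have He k i (h : R) : `|h| <= s ^+ k / 500 / 2 ->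
    `|iter k (S1 eps) d0 i * (1 + h) - iter k (S1 eps) d0 i| <= B * s ^+ k.
  move=> hh; rewrite mulrDr mulr1 addrAC subrr add0r.
  apply: le_trans (ler_normM (hB k i) hh) _.
  by have := sk0 k; nra.
have [G hG] : exists G : R -> R, forall k x,
    `|G x - iter k (S1 eps) d0 (Num.floor (x * 2 ^+ k))|
    <= B / (1 - s) * s ^+ k.
  apply: (dyadic_limit (D := fun k => iter k (S1 eps) d0)) => // k i;
    rewrite iterS ?S1_even ?S1_odd; apply: He; rewrite ?normrN;
    exact: Hval_le (hm k) (hit k) i.
have hmod := dyadic_limit_modulus (D := fun k => iter k (S1 eps) d0) s0 B0 _ hG.
have {}hmod : forall k x y, `|x - y| <= 2 ^- k ->
    `|G x - G y| <= (2 * (B / (1 - s)) + B) * s ^+ k.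
  apply: hmod => k i; apply: le_trans (ler_reldiff i (hit k)) _.
  have := sk0 k; have := hB k i.
  by have := normr_ge0 (iter k (S1 eps) d0 i); nra.
exists G; split.
- exact: dyadic_modulus_continuous s01 hmod.
- exists a => // theta /andP[th0 th1].
  (* No derivative is taken, as alpha < 1; theta < theta0 = a keeps the exponent positive. *)
  exists 0%N, (a - theta); split; rewrite ?add0r//.
    by apply/andP; split; lra.
  have c0 : 0 <= B / (1 - s) by rewrite divr_ge0//; lra.
  (* The sup bound M = B / (1 - s) + B comes from comparing G with the data at level 0. *)
  exists ((2 * (B / (1 - s)) + B) * 2 `^ (a - theta)
    + 2 * (B / (1 - s) + B)).
  move=> x y; rewrite derive1n0; apply: dyadic_modulus_hoelder hmod _ _ _ => //.
  + by rewrite subr_gt0.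
  + by rewrite s0 /s; apply: ler_powR; lra.
  + by lra.
  + move=> z; have := hG 0 z; have := dB (Num.floor (z * 2 ^+ 0)) => /=.
    by rewrite !ler_norml mulr1 => /andP[? ?] /andP[? ?];
      apply/andP; split; lra.
- exact: subdivision_converges_geometric s01 hG.
Qed.
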